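(* Consider the following statements for a topological space $X$. (1) $X$ is hyperconnected. (2) Any cardinal number $\kappa > 0$ is a precaliber for $X$. (3) There is a finite cardinal $k > 1$ that is a precaliber for $X$. (4) Any cardinal number $\kappa > 0$ is a weak precaliber for $X$. (5) There is a finite cardinal $k > 1$ that is a weak precaliber for $X$. (6) Any cardinal number $\kappa > 0$ is a precaliber* for $X$. (7) There is a finite cardinal $k > 1$ that is a precaliber* for $X$. (8) Any cardinal number $\kappa > 0$ is a weak precaliber* for $X$. (9) There is a finite cardinal $k > 1$ that is a weak precaliber* for $X$. Then: (a) (1)–(5) are equivalent. (b) (2) implies (6), (3) implies (7), (4) implies (8), and (5) implies (9). (c) (6) implies (7), (6) implies (8), (8) implies (9), and (7) implies (9). (d) (9) implies (1) when $o(X)\geq \omega$. In particular, if $\tau_X$ is infinite, then (1)–(9) are equivalent.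
   Context: For a topological space $X$, $\tau_X$ is its topology, $\tau_X^+=\tau_X\setminus\{\emptyset\}$ and $o(X)=|\tau_X|$. $X$ is hyperconnected if any two non-empty open subsets of $X$ intersect. A family of sets is centered if every non-empty finite subfamily has non-empty intersection, and a family in $\tau_X^+$ is linked if any two members intersect. Here the following notions are used for all cardinals $\kappa>0$, finite ones included. $\kappa$ is a precaliber (resp. weak precaliber) for $X$ if for every indexed family $\{U_\alpha:\alpha<\kappa\}\subseteq\tau_X^+$ (repetitions allowed) there is $J\subseteq\kappa$ with $|J|=\kappa$ such that $\{U_\alpha:\alpha\in J\}$ is centered (resp. linked). $\kappa$ is a precaliber* (resp. weak precaliber* ) for $X$ if for every set $\mathcal U\subseteq\tau_X^+$ with $|\mathcal U|=\kappa$ there is $\mathcal V\subseteq\mathcal U$ with $|\mathcal V|=\kappa$ such that $\mathcal V$ is centered (resp. linked). *)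

(* Defs.v *)
From mathcomp Require Export all_boot.
From mathcomp Require Export mathcomp_extra boolp classical_sets functions.
From mathcomp Require Export cardinality topology.

Set Implicit Arguments.
Unset Strict Implicit.
Unset Printing Implicit Defensive.

Local Open Scope classical_set_scope.
Local Open Scope card_scope.

(* `\ removes the single point set0, so opens_plus X is tau_X^+. *)
Definition opens (X : topologicalType) : set (set X) := [set A | open A].
Arguments opens X : clear implicits.
Definition opens_plus (X : topologicalType) : set (set X) :=
  opens X `\ set0.
Arguments opens_plus X : clear implicits.

Definition hyperconnected (X : topologicalType) : Prop :=
  forall A B : set X, opens_plus X A -> opens_plus X B -> A `&` B !=set0.

Definition centered (T : Type) (F : set (set T)) : Prop :=
  forall G : set (set T), G `<=` F -> finite_set G -> G !=set0 ->
    \bigcap_(A in G) A !=set0.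

Definition linked (T : Type) (F : set (set T)) : Prop :=
  forall A B : set T, F A -> F B -> A `&` B !=set0.

(* A cardinal kappa is represented by a type K of that cardinality, and
   |J| = kappa is rendered as equipotence with [set: K]; a finite cardinal k is
   represented by 'I_k. *)

Definition precaliber (X : topologicalType) (K : Type) : Prop :=
  forall U : K -> set X, (forall a, opens_plus X (U a)) ->
  exists J : set K, J #= [set: K] /\ centered (U @` J).

Definition weak_precaliber (X : topologicalType) (K : Type) : Prop :=
  forall U : K -> set X, (forall a, opens_plus X (U a)) ->
  exists J : set K, J #= [set: K] /\ linked (U @` J).

Definition precaliber_star (X : topologicalType) (K : Type) : Prop :=
  forall U : set (set X), U `<=` opens_plus X -> U #= [set: K] ->
  exists V : set (set X), [/\ V `<=` U, V #= [set: K] & centered V].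

Definition weak_precaliber_star (X : topologicalType) (K : Type) : Prop :=
  forall U : set (set X), U `<=` opens_plus X -> U #= [set: K] ->
  exists V : set (set X), [/\ V `<=` U, V #= [set: K] & linked V].

(* Main.v *)
Require Import Defs.
From mathcomp Require Import finmap.

(** In a hyperconnected space the non-empty open sets are closed under finite
    intersection, so every family of them is centered and every precaliber
    property holds with the whole family as witness.  Conversely, a subfamily
    of full cardinality of a family indexed by a finite [k] is the family
    itself, so for a finite [k] a (weak) precaliber says something about every
    pair of members of every family of size [k].  It remains to place two given
    non-empty open sets [A] and [B] in such a family.  With repetitions allowed,
    any [k > 1] permits the family that takes only the values [A] and [B].
    Without repetitions one needs [k] distinct open sets, which exist for every
    [k] when the topology is infinite: [injection_from_pair] extends [A], [B] to
    an infinite sequence of distinct members.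

    An injectively indexed family is the same as a set of open sets, which gives
    the passage from precalibers to their starred versions; and a centered
    family is linked, which gives the passage to the weak versions. *)

Set Implicit Arguments.
Unset Strict Implicit.

Local Open Scope classical_set_scope.
Local Open Scope card_scope.

Lemma sub_card_eq_finite (T : choiceType) (A B : set T) :
  finite_set B -> A `<=` B -> A #= B -> A = B.
Proof.
move=> finB sAB cAB; have finA := sub_finite_set sAB finB.
apply: fset_set_inj => //; apply/eqP; rewrite eqEfcard.
have -> : (fset_set A `<=` fset_set B)%fset by rewrite -fset_set_sub.
by move/(fcard_eq finA finB): cAB => ->; rewrite leqnn.
Qed.

(** The enumeration [A, B, f 0, f 1, ...], where [f] enumerates injectively
    part of the infinite set [S `\` [set A; B]]. *)
Lemma injection_from_pair (T : pointedType) (S : set T) (A B : T) :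
  infinite_set S -> S A -> S B -> A <> B ->
  exists g : nat -> T,
    [/\ injective g, forall n, S (g n), g 0 = A & g 1 = B].
Proof.
move=> infS SA SB AB.
have /infiniteP/pcard_leP[f] : infinite_set (S `\` [set A; B]).
  by apply: infinite_setD => //; exact: finite_set2.
have fS n : (S `\` [set A; B]) (f n) by exact: funS.
have fA n : f n <> A by move=> fnA; have [_] := fS n; apply; left.
have fB n : f n <> B by move=> fnB; have [_] := fS n; apply; right.
exists (fun n => match n with 0 => A | 1 => B | m.+2 => f m end).
split=> //; last by case=> [|[|n]] //; have [] := fS n.
move=> [|[|m]] [|[|n]] // eqg; try by
  [case: AB | case: (fA n) | case: (fB n) | case: (fA m) | case: (fB m)].
by congr _.+2; apply: (@inj _ _ _ f) eqg; rewrite in_setT.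
Qed.

Lemma centered_linked (T : Type) (F : set (set T)) : centered F -> linked F.
Proof.
move=> cF A B FA FB.
have [||x Gx] := cF [set A; B] _ (finite_set2 A B); last 1 first.
- by exists x; split; apply: Gx; [left|right].
- by move=> C [->|->].
- by exists A; left.
Qed.

Section Precalibers.
Variable X : topologicalType.
Implicit Types (A B : set X) (F : set (set X)) (K : Type).

(** Binary intersections suffice to make the non-empty open sets closed under
    finite ones; the empty intersection is the whole space, which has a point
    because the subfamily has a member. *)
Lemma hyperconnected_centered F :
  hyperconnected X -> F `<=` opens_plus X -> centered F.
Proof.
move=> hX FX G GF /finite_seqP[s Gs] [A GA].
have [_ /eqP/set0P[x _]] : opens_plus X A by apply/FX/GF.
have {GA GF FX} : forall C, C \in s -> opens_plus X C.
  by move=> C Cs; apply/FX/GF; rewrite Gs.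
rewrite {G}Gs => sX.
suff [_ /eqP/set0P] : opens_plus X (\bigcap_(C in [set` s]) C) by [].
rewrite bigcap_seq big_seq; elim/big_ind: _ => //.
- split; first exact: openT.
  by move=> T0; have : [set: X] x by []; rewrite T0.
- move=> C D CX DX; split; last by apply/eqP/set0P; exact: hX.
  by case: CX DX => oC _ [oD _]; exact: openI.
Qed.

Lemma hyperconnected_precaliber K : hyperconnected X -> precaliber X K.
Proof.
move=> hX U UX; exists setT; split; first exact: card_eqxx.
by apply: hyperconnected_centered => // _ [a _ <-].
Qed.

Lemma precaliber_weak K : precaliber X K -> weak_precaliber X K.
Proof.
move=> pK U UX; have [J [JK cJ]] := pK U UX.
by exists J; split=> //; exact: centered_linked.
Qed.

Lemma precaliber_star_weak K : precaliber_star X K -> weak_precaliber_star X K.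
Proof.
move=> pK U UX UK; have [V [VU VK cV]] := pK U UX UK.
by exists V; split=> //; exact: centered_linked.
Qed.

(** A set of open sets equipotent with [K] is an injective family indexed by
    [K], and injectivity makes the image of [J] equipotent with [J].  The
    property [P] stands for being centered or linked. *)
Lemma star_of_indexed (P : set (set X) -> Prop) K :
  (forall U : K -> set X, (forall a, opens_plus X (U a)) ->
    exists J : set K, J #= [set: K] /\ P (U @` J)) ->
  forall F, F `<=` opens_plus X -> F #= [set: K] ->
    exists V, [/\ V `<=` F, V #= [set: K] & P V].
Proof.
move=> pK F FX; rewrite card_eq_sym => /card_set_bijP[U [UF Uinj _]].
have [|J [JK PJ]] := pK U; first by move=> a; apply: FX; exact: UF.
exists (U @` J); split=> //; first by move=> _ [a _ <-]; exact: UF.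
apply: card_eq_trans JK; apply: inj_card_eq => a b _ _.
by apply: Uinj; rewrite in_setT.
Qed.

Lemma precaliber_starW K : precaliber X K -> precaliber_star X K.
Proof. exact: star_of_indexed. Qed.

Lemma weak_precaliber_starW K :
  weak_precaliber X K -> weak_precaliber_star X K.
Proof. exact: star_of_indexed. Qed.

(** For finite [k] the witness [J] is all of ['I_k], so a family taking only the
    values [A] and [B] is itself linked. *)
Lemma finite_weak_precaliber_hyperconnected k :
  1 < k -> weak_precaliber X 'I_k -> hyperconnected X.
Proof.
move=> k1 pk A B AX BX.
pose U (i : 'I_k) := if i == 0 :> nat then A else B.
have [i|J [Jk]] := pk U; first by rewrite /U; case: ifP.
rewrite (sub_card_eq_finite finite_finset (@subsetT _ J) Jk) => lU.
by apply: lU; [exists (Ordinal (ltnW k1))|exists (Ordinal k1)].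
Qed.

(** The family must now have exactly [k] distinct members; the infinite topology
    provides the [k - 2] that complete [A] and [B], and finiteness again forces
    the linked subset to be everything. *)
Lemma finite_weak_precaliber_star_hyperconnected k :
  infinite_set (opens X) -> 1 < k -> weak_precaliber_star X 'I_k ->
  hyperconnected X.
Proof.
move=> infX k1 pk A B AX BX.
have [<-|/eqP AB] := eqVneq A B.
  by rewrite setIid; apply/set0P/eqP; case: AX.
have infX' : infinite_set (opens_plus X).
  by apply: infinite_setD => //; exact: finite_set1.
have [g [ginj gX g0 g1]] := injection_from_pair infX' AX BX AB.
have gk : g @` `I_k #= [set: 'I_k].
  apply: card_eq_trans card_II; apply: inj_card_eq => m n _ _; exact: ginj.
have [|V [Vg Vk lV]] := pk (g @` `I_k) _ gk; first by move=> _ [n _ <-].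
have VE : V = g @` `I_k.
  apply: sub_card_eq_finite => //; first exact/finite_image/finite_II.
  by apply: card_eq_trans Vk _; rewrite card_eq_sym.
by apply: lV; rewrite VE; [exists 0 => //; exact: ltnW|exists 1].
Qed.

End Precalibers.

Theorem proposition3p33 (X : topologicalType) :
  let S1 := hyperconnected X in
  let S2 := forall K : Type, inhabited K -> precaliber X K in
  let S3 := exists k : nat, (1 < k)%N /\ precaliber X 'I_k in
  let S4 := forall K : Type, inhabited K -> weak_precaliber X K in
  let S5 := exists k : nat, (1 < k)%N /\ weak_precaliber X 'I_k in
  let S6 := forall K : Type, inhabited K -> precaliber_star X K in
  let S7 := exists k : nat, (1 < k)%N /\ precaliber_star X 'I_k in
  let S8 := forall K : Type, inhabited K -> weak_precaliber_star X K in
  let S9 := exists k : nat, (1 < k)%N /\ weak_precaliber_star X 'I_k in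
  [/\ (* (a) *) [<-> S1; S2; S3; S4; S5],
      (* (b) *) [/\ S2 -> S6, S3 -> S7, S4 -> S8 & S5 -> S9],
      (* (c) *) [/\ S6 -> S7, S6 -> S8, S8 -> S9 & S7 -> S9],
      (* (d) *) ([set: nat] #<= opens X -> S9 -> S1)
    & infinite_set (opens X) -> [<-> S1; S2; S3; S4; S5; S6; S7; S8; S9]].
Proof.
move=> S1 S2 S3 S4 S5 S6 S7 S8 S9.
have S12 : S1 -> S2 by move=> hX K _; exact: hyperconnected_precaliber.
have S23 : S2 -> S3.
  by move=> pX; exists 2; split=> //; apply: pX; exact: (inhabits ord0).
have S67 : S6 -> S7.
  by move=> pX; exists 2; split=> //; apply: pX; exact: (inhabits ord0).
have S45 : S4 -> S5.
  by move=> pX; exists 2; split=> //; apply: pX; exact: (inhabits ord0).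
have S89 : S8 -> S9.
  by move=> pX; exists 2; split=> //; apply: pX; exact: (inhabits ord0).
have S24 : S2 -> S4 by move=> pX K K0; exact/precaliber_weak/pX.
have S35 : S3 -> S5.
  by move=> [k [k1 pk]]; exists k; split=> //; exact: precaliber_weak.
have S68 : S6 -> S8 by move=> pX K K0; exact/precaliber_star_weak/pX.
have S79 : S7 -> S9.
  by move=> [k [k1 pk]]; exists k; split=> //; exact: precaliber_star_weak.
have S26 : S2 -> S6 by move=> pX K K0; exact/precaliber_starW/pX.
have S37 : S3 -> S7.
  by move=> [k [k1 pk]]; exists k; split=> //; exact: precaliber_starW.
have S48 : S4 -> S8 by move=> pX K K0; exact/weak_precaliber_starW/pX.
have S59 : S5 -> S9.
  by move=> [k [k1 pk]]; exists k; split=> //; exact: weak_precaliber_starW.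
have S51 : S5 -> S1.
  by move=> [k [k1 pk]]; exact: finite_weak_precaliber_hyperconnected pk.
have S91 : infinite_set (opens X) -> S9 -> S1.
  move=> infX [k [k1 pk]].
  exact: finite_weak_precaliber_star_hyperconnected pk.
split=> //.
- by tfae; tauto.
- by move/infiniteP; exact: S91.
- by move=> /S91 {}S91; tfae; tauto.
Qed.
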